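(* Proof search in the sequent calculus $\mathsf{G4iSL}_\Box$ terminates modulo extended axioms.
   Context: Formulas are built from the constant $\bot$, atoms (propositional variables) $p,q,r,\dots$, binary connectives $\wedge,\vee,\to$ and the unary modal operator $\Box$ (there is no $\Diamond$); $\neg\varphi$ abbreviates $\varphi\to\bot$; $\bot$ is not an atom. A sequent is an expression $\Gamma\Rightarrow\Delta$ with $\Gamma,\Delta$ finite multisets of formulas, $\Delta$ containing at most one formula. $\Gamma,\Pi$ denotes multiset union. $\Box\Gamma$ is the multiset $\{\Box\varphi\mid\varphi\in\Gamma\}$ and $\boxdot\Gamma=\Gamma\cup\Box\Gamma$ (multiset union). A formula is boxed if it has the form $\Box\psi$. The calculus $\mathsf{G4iSL}_\Box$ has the following axioms and rules (''from premises infer conclusion''): At: $\Gamma,p\Rightarrow p$ ($p$ an atom). $L\bot$: $\Gamma,\bot\Rightarrow\Delta$. $R\wedge$: from $\Gamma\Rightarrow\varphi$ and $\Gamma\Rightarrow\psi$ infer $\Gamma\Rightarrow\varphi\wedge\psi$. $L\wedge$: from $\Gamma,\varphi,\psi\Rightarrow\Delta$ infer $\Gamma,\varphi\wedge\psi\Rightarrow\Delta$. $R\vee$: from $\Gamma\Rightarrow\varphi_i$ ($i=0$ or $1$) infer $\Gamma\Rightarrow\varphi_0\vee\varphi_1$. $L\vee$: from $\Gamma,\varphi\Rightarrow\Delta$ and $\Gamma,\psi\Rightarrow\Delta$ infer $\Gamma,\varphi\vee\psi\Rightarrow\Delta$. $R{\to}$: from $\Gamma,\varphi\Rightarrow\psi$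 infer $\Gamma\Rightarrow\varphi\to\psi$. $Lp{\to}$: from $\Gamma,p,\varphi\Rightarrow\Delta$ infer $\Gamma,p,p\to\varphi\Rightarrow\Delta$ ($p$ an atom). $L{\wedge}{\to}$: from $\Gamma,\varphi\to(\psi\to\gamma)\Rightarrow\Delta$ infer $\Gamma,\varphi\wedge\psi\to\gamma\Rightarrow\Delta$. $L{\vee}{\to}$: from $\Gamma,\varphi\to\gamma,\psi\to\gamma\Rightarrow\Delta$ infer $\Gamma,\varphi\vee\psi\to\gamma\Rightarrow\Delta$. $L{\to}{\to}$: from $\Gamma,\psi\to\gamma\Rightarrow\varphi\to\psi$ and $\Gamma,\gamma\Rightarrow\Delta$ infer $\Gamma,(\varphi\to\psi)\to\gamma\Rightarrow\Delta$. $\to_{\rm SL}$: from $\Pi,\boxdot\Gamma,\Box\varphi,\Box\varphi\to\psi\Rightarrow\varphi$ and $\Pi,\Box\Gamma,\psi\Rightarrow\Delta$ infer $\Pi,\Box\Gamma,\Box\varphi\to\psi\Rightarrow\Delta$, where $\Pi$ contains no boxed formulas. $\mathcal R^4_{\rm SL}$: from $\Pi,\boxdot\Gamma,\Box\varphi\Rightarrow\varphi$ infer $\Pi,\Box\Gamma\Rightarrow\Box\varphi$, where $\Pi$ contains no boxed formulas. An extended axiom is a sequent $\Gamma\Rightarrow\Delta$ for which $\Gamma\cap\Delta\neq\emptyset$ (the succedent formula occurs in the antecedent). Proof search in a calculus terminates modulo extended axioms if bottom-up proof search always terminates provided one stops searching along a branch whenever an extended axiom is reached; that is, for every sequent $S$,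 the tree obtained from $S$ by repeatedly applying all possible rules backwards (going from conclusion to premises), where extended axioms are not expanded further, is finite. *)

(* Defs.v *)
From HB Require Import structures.
From mathcomp Require Import all_boot finmap multiset.
From mathcomp Require Import classical_sets cardinality.
Set Implicit Arguments.
Unset Strict Implicit.
Unset Printing Implicit Defensive.

Local Open Scope mset_scope.

Inductive formula : Type :=
| Bot
| Atom of nat
| And of formula & formula
| Or of formula & formula
| Imp of formula & formula
| Box of formula.

(* The encoding into [GenTree.tree nat] only serves to give [formula] the
   choice structure that [{mset formula}] requires. *)
Fixpoint tree_of_formula (a : formula) : GenTree.tree nat :=
  match a with
  | Bot => GenTree.Node 0 [::]
  | Atom p => GenTree.Leaf p
  | And a b => GenTree.Node 1 [:: tree_of_formula a; tree_of_formula b]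
  | Or a b => GenTree.Node 2 [:: tree_of_formula a; tree_of_formula b]
  | Imp a b => GenTree.Node 3 [:: tree_of_formula a; tree_of_formula b]
  | Box a => GenTree.Node 4 [:: tree_of_formula a]
  end.

Fixpoint formula_of_tree (t : GenTree.tree nat) : formula :=
  match t with
  | GenTree.Leaf p => Atom p
  | GenTree.Node 1 [:: a; b] => And (formula_of_tree a) (formula_of_tree b)
  | GenTree.Node 2 [:: a; b] => Or (formula_of_tree a) (formula_of_tree b)
  | GenTree.Node 3 [:: a; b] => Imp (formula_of_tree a) (formula_of_tree b)
  | GenTree.Node 4 [:: a] => Box (formula_of_tree a)
  | GenTree.Node _ _ => Bot
  end.

Lemma tree_of_formulaK : cancel tree_of_formula formula_of_tree.
Proof. by elim=> //= [a -> b ->|a -> b ->|a -> b ->|a ->]. Qed.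

HB.instance Definition _ := Countable.copy formula (can_type tree_of_formulaK).

(* A multiset with at most one element is represented by an [option]. *)
Definition sequent : Type := ({mset formula} * option formula)%type.

Notation "Γ ⇒ D" := ((Γ, D) : sequent) (at level 70, no associativity).

Definition boxed (a : formula) : bool := if a is Box _ then true else false.

(* [Γ] is coerced to the sequence listing its elements with multiplicity. *)
Definition box_mset (Γ : {mset formula}) : {mset formula} :=
  seq_mset [seq Box a | a <- Γ].

Definition boxdot_mset (Γ : {mset formula}) : {mset formula} :=
  Γ `+` box_mset Γ.

Definition box_free (Π : {mset formula}) : Prop :=
  forall a : formula, a \in Π -> ~~ boxed a.

Implicit Types (p : nat) (a b c : formula) (D : option formula).
Implicit Types (Γ Π : {mset formula}).

(* A calculus is given by its rule instances: [C premises conclusion]; an axiom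
   is an instance without premises. *)
Definition calculus : Type := seq sequent -> sequent -> Prop.

Inductive G4iSL_box : calculus :=
| ax_At Γ p :
    G4iSL_box [::] (Atom p +` Γ ⇒ Some (Atom p))
| ax_Lbot Γ D :
    G4iSL_box [::] (Bot +` Γ ⇒ D)
| rule_Rand Γ a b :
    G4iSL_box [:: Γ ⇒ Some a; Γ ⇒ Some b] (Γ ⇒ Some (And a b))
| rule_Land Γ a b D :
    G4iSL_box [:: a +` (b +` Γ) ⇒ D] (And a b +` Γ ⇒ D)
| rule_Ror0 Γ a b :
    G4iSL_box [:: Γ ⇒ Some a] (Γ ⇒ Some (Or a b))
| rule_Ror1 Γ a b :
    G4iSL_box [:: Γ ⇒ Some b] (Γ ⇒ Some (Or a b))
| rule_Lor Γ a b D :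
    G4iSL_box [:: a +` Γ ⇒ D; b +` Γ ⇒ D] (Or a b +` Γ ⇒ D)
| rule_Rimp Γ a b :
    G4iSL_box [:: a +` Γ ⇒ Some b] (Γ ⇒ Some (Imp a b))
| rule_Lpimp Γ p a D :
    G4iSL_box [:: Atom p +` (a +` Γ) ⇒ D]
              (Atom p +` (Imp (Atom p) a +` Γ) ⇒ D)
| rule_Landimp Γ a b c D :
    G4iSL_box [:: Imp a (Imp b c) +` Γ ⇒ D] (Imp (And a b) c +` Γ ⇒ D)
| rule_Lorimp Γ a b c D :
    G4iSL_box [:: Imp a c +` (Imp b c +` Γ) ⇒ D] (Imp (Or a b) c +` Γ ⇒ D)
| rule_Limpimp Γ a b c D :
    G4iSL_box [:: Imp b c +` Γ ⇒ Some (Imp a b); c +` Γ ⇒ D]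
              (Imp (Imp a b) c +` Γ ⇒ D)
| rule_impSL Π Γ a b D of box_free Π :
    G4iSL_box
      [:: Imp (Box a) b +` (Box a +` (Π `+` boxdot_mset Γ)) ⇒ Some a;
          b +` (Π `+` box_mset Γ) ⇒ D]
      (Imp (Box a) b +` (Π `+` box_mset Γ) ⇒ D)
| rule_R4SL Π Γ a of box_free Π :
    G4iSL_box [:: Box a +` (Π `+` boxdot_mset Γ) ⇒ Some a]
              (Π `+` box_mset Γ ⇒ Some (Box a)).

Definition extended_axiom (S : sequent) : bool :=
  if S.2 is Some a then a \in S.1 else false.

(* Nodes of the proof search tree of a sequent are represented by their path
   from the root (so equal sequents at different places are different nodes):
   a step [(ps, i)] applies a rule instance with premises [ps] backwards and
   moves to the [i]-th premise.  Extended axioms have no children. *)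
Inductive search_node (C : calculus) : sequent -> seq (seq sequent * nat) -> Prop :=
| search_root S :
    search_node C S [::]
| search_child S ps i nu of
    ~~ extended_axiom S & C ps S & i < size ps & search_node C (nth S ps i) nu :
    search_node C S ((ps, i) :: nu).

Definition terminates_modulo_extended_axioms (C : calculus) : Prop :=
  forall S : sequent, finite_set (search_node C S : set _).

(* Main.v *)
Require Import Defs.
From mathcomp Require Import all_boot finmap multiset zify.
From mathcomp Require Import classical_sets cardinality.
Set Implicit Arguments.
Unset Strict Implicit.
Unset Printing Implicit Defensive.

(** No rule deletes a boxed formula from the antecedent when read backwards,
    and the boxed subformulas of the premises are among those of the
    conclusion.  A modal premise (that of [rule_R4SL], or the left one of
    [rule_impSL]) adds a formula [Box a] to the antecedent.  If [Box a] is
    already there then, for [rule_R4SL], the conclusion is an extended axiom,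
    and for [rule_impSL] the premise is one: [Box a] is in the boxed part of
    the antecedent, so that [a], the succedent of the premise, is in its
    antecedent.  Otherwise the number of boxed subformulas that are missing
    from the antecedent drops.  All other premises are smaller for Dyckhoff's
    order on sequents.  Hence every branch is finite, and since a sequent is
    the conclusion of finitely many rule instances, so is the tree. *)

Local Open Scope mset_scope.

(** * Predicates and sums over multisets *)

Section Multisets.
Variable K : choiceType.
Implicit Types (x : K) (A B : {mset K}) (P : pred K).

Lemma perm_enum_msetD A B : perm_eq (A `+` B) (A ++ B).
Proof.
by apply/allP => x _ /=; rewrite count_cat !count_mem_mset msetE2 eqxx.
Qed.

Lemma all_msetD P A B : all P (A `+` B) = all P A && all P B.
Proof. by rewrite (perm_all _ (perm_enum_msetD A B)) all_cat. Qed.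

Lemma all_mset1D P x A : all P (x +` A) = P x && all P A.
Proof. by rewrite all_msetD enum_msetn /= andbT. Qed.

Lemma sum_msetD (f : K -> nat) A B :
  \sum_(x <- A `+` B) f x = (\sum_(x <- A) f x + \sum_(x <- B) f x)%N.
Proof. by rewrite (perm_big _ (perm_enum_msetD A B)) big_cat. Qed.

Lemma sum_mset1D (f : K -> nat) x A :
  \sum_(y <- x +` A) f y = (f x + \sum_(y <- A) f y)%N.
Proof. by rewrite sum_msetD enum_msetn big_seq1. Qed.

End Multisets.

Lemma ltn_sub_count (T : eqType) (P Q : pred T) (s : seq T) x :
  subpred P Q -> x \in s -> Q x -> ~~ P x -> count P s < count Q s.
Proof.
move=> PQ xs Qx nPx; elim: s xs => //= y s IH.
have PQs : count P s <= count Q s by apply: sub_count.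
rewrite inE => /predU1P[<-|/IH]; first by rewrite Qx (negPf nPx); lia.
by have := PQ y; case: (P y) => [/(_ isT)->|_] //=; case: (Q y) => /=; lia.
Qed.

(** * From accessible sequents to finite search trees *)

Section FiniteSearch.
Variable C : calculus.

Definition expands (T S : sequent) : Prop :=
  ~~ extended_axiom S /\ exists2 ps, C ps S & T \in ps.

(** Well-founded induction: a node is the root, or one of finitely many steps followed by a node of
    the tree of a premise. The list [instances S] need only contain all instances with conclusion
    [S]. *)
Lemma finite_search_node (instances : sequent -> seq (seq sequent)) S :
  (forall ps S, C ps S -> ps \in instances S) ->
  Acc expands S -> finite_set (search_node C S : set _).
Proof.
move=> instancesP; elim=> {}S _ IH.
pose steps := [seq (ps, i) | ps <- instances S, i <- iota 0 (size ps)].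
pose D := [set qi | qi \in steps /\ expands (nth S qi.1 qi.2) S]%classic.
pose F qi := [set qi :: nu | nu in search_node C (nth S qi.1 qi.2)]%classic.
apply: (@sub_finite_set _ _ ([set [::]] `|` \bigcup_(qi in D) F qi)%classic).
  move=> nu; move ES : S => S' node.
  case: node ES => [?|S0 ps i mu nax Cps lti mu_node] ES; first by left.
  subst S0; right; exists (ps, i) => /=; last by exists mu.
  split; last by split=> //; exists ps => //=; apply: mem_nth.
  by apply/allpairsPdep; exists ps, i; split; rewrite ?instancesP ?mem_iota.
rewrite finite_setU; split; first exact: (finite_set1 [::]).
apply: bigcup_finite => [|qi [_ /IH fin]]; last exact: finite_image.
by apply: sub_finite_set (finite_seq steps) => qi [].
Qed.

End FiniteSearch.

(** * Finitely many rule instances per conclusion *)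

Lemma mem_box_mset a (G : {mset formula}) : (Box a \in box_mset G) = (a \in G).
Proof.
by rewrite (perm_mem (perm_eq_seq_mset _)) mem_map // => ? ? [].
Qed.

(** As [Π] is box-free, the antecedent of a modal conclusion determines [Π] and [Γ]; this recovers
    [Γ]. *)
Definition unbox_mset (G : {mset formula}) : {mset formula} :=
  seq_mset (pmap (fun a => if a is Box b then Some b else None) G).

Lemma box_msetK (P G : {mset formula}) :
  box_free P -> unbox_mset (P `+` box_mset G) = G.
Proof.
move=> Pfree; rewrite -[RHS]seq_mset_id; apply/eq_seq_msetP.
apply: perm_trans (perm_pmap _ (perm_enum_msetD _ _)) _; rewrite pmap_cat.
rewrite (_ : pmap _ P = [::]).
  apply: perm_trans (perm_pmap _ (perm_eq_seq_mset _)) _.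
  by rewrite map_pK.
have /allP : {in enum_mset P, forall a, ~~ boxed a} by [].
by elim: (enum_mset P) => //= -[] //= *; auto.
Qed.

(** An overapproximation with [x] as principal formula: side conditions, such as the presence of the
    atom in [rule_Lpimp], are not checked. *)
Definition left_instances (S : sequent) (x : formula) : seq (seq sequent) :=
  let: (G, D) := S in
  let: H := G `\ x in
  match x with
  | Bot | Atom _ => [:: [::]]
  | And a b => [:: [:: a +` (b +` H) ⇒ D]]
  | Or a b => [:: [:: a +` H ⇒ D; b +` H ⇒ D]]
  | Imp (Atom _) a => [:: [:: a +` H ⇒ D]]
  | Imp (And a b) c => [:: [:: Imp a (Imp b c) +` H ⇒ D]]
  | Imp (Or a b) c => [:: [:: Imp a c +` (Imp b c +` H) ⇒ D]]
  | Imp (Imp a b) c => [:: [:: Imp b c +` H ⇒ Some (Imp a b); c +` H ⇒ D]]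
  | Imp (Box a) b =>
      [:: [:: x +` (Box a +` (H `+` unbox_mset H)) ⇒ Some a; b +` H ⇒ D]]
  | _ => [::]
  end.

Definition right_instances (S : sequent) : seq (seq sequent) :=
  let: (G, D) := S in
  match D with
  | Some (And a b) => [:: [:: G ⇒ Some a; G ⇒ Some b]]
  | Some (Or a b) => [:: [:: G ⇒ Some a]; [:: G ⇒ Some b]]
  | Some (Imp a b) => [:: [:: a +` G ⇒ Some b]]
  | Some (Box a) => [:: [:: Box a +` (G `+` unbox_mset G) ⇒ Some a]]
  | _ => [::]
  end.

Definition instances (S : sequent) : seq (seq sequent) :=
  right_instances S ++ flatten [seq left_instances S x | x <- S.1].

Lemma left_instances_sub x G D ps :
  ps \in left_instances (x +` G ⇒ D) x -> ps \in instances (x +` G ⇒ D).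
Proof.
move=> psP; rewrite mem_cat; apply/orP; right.
by apply/flatten_mapP; exists x; rewrite ?mset1D1.
Qed.

Lemma right_instances_sub S ps : ps \in right_instances S -> ps \in instances S.
Proof. by rewrite mem_cat => ->. Qed.

Lemma instancesP ps S : G4iSL_box ps S -> ps \in instances S.
Proof.
case=> [G p|G D|G a b|G a b D|G a b|G a b|G a b D|G a b|G p a D|G a b c D|
        G a b c D|G a b c D|P G a b D Pfree|P G a Pfree].
(* In [rule_Lpimp] the implication, not the atom, is principal and has to come first. *)
9: rewrite [Atom p +` _]msetDCA [X in instances (X, _)]msetDCA.
1,2,4,7,9-13: apply: left_instances_sub; rewrite /left_instances ?msetD1K.
10-14: apply: right_instances_sub.
1-8,10,11,13: exact: mem_head.
- by rewrite box_msetK // -msetDA [box_mset G `+` G]msetDC mem_head.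
- by rewrite in_cons mem_head orbT.
- by rewrite /right_instances box_msetK // -msetDA [box_mset G `+` G]msetDC mem_head.
Qed.

(* Dyckhoff's weight; the surcharge for [And] makes [Imp a (Imp b c)] lighter
   than [Imp (And a b) c]. *)
Fixpoint weight (a : formula) : nat :=
  match a with
  | Bot | Atom _ => 0
  | And a b => (weight a + weight b).+2
  | Or a b | Imp a b => (weight a + weight b).+1
  | Box a => (weight a).+1
  end.

(* Base 3, as a rule replaces a formula by at most two lighter ones in each
   premise. *)
Definition cost (a : formula) : nat := 3 ^ weight a.

Definition seq_cost (S : sequent) : nat :=
  \sum_(a <- S.1) cost a + (if S.2 is Some a then cost a else 0).

Fixpoint boxed_subformulas (a : formula) : seq formula :=
  match a with
  | Bot | Atom _ => [::]
  | And a b | Or a b | Imp a b => boxed_subformulas a ++ boxed_subformulas b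
  | Box b => a :: boxed_subformulas b
  end.

(** * Lexicographic descent along a branch *)

Section Descent.
Variable U : seq formula.

Definition boxes_in (a : formula) : bool := all (mem U) (boxed_subformulas a).

Definition seq_boxes_in (S : sequent) : bool :=
  all boxes_in S.1 && (if S.2 is Some a then boxes_in a else true).

Definition missing (S : sequent) : nat :=
  count [pred a | boxed a && (a \notin S.1)] U.

Lemma boxes_in_connective a b :
  (boxes_in (And a b) = boxes_in a && boxes_in b) *
  (boxes_in (Or a b) = boxes_in a && boxes_in b) *
  (boxes_in (Imp a b) = boxes_in a && boxes_in b).
Proof. by rewrite /boxes_in /= !all_cat. Qed.

Lemma boxes_in_Box a : boxes_in (Box a) = (Box a \in U) && boxes_in a.
Proof. by []. Qed.

Lemma all_box_mset (G : {mset formula}) :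
  all boxes_in (box_mset G) -> all boxes_in G.
Proof.
rewrite (perm_all _ (perm_eq_seq_mset _)) all_map; apply: sub_all => a /=.
by rewrite boxes_in_Box => /andP[].
Qed.

(** The left implication rules may create new implications, but no rule creates a new boxed
    subformula: the [Box a] added by a modal rule already occurs in its principal formula. *)
Lemma seq_boxes_in_premise ps S T :
  G4iSL_box ps S -> T \in ps -> seq_boxes_in S -> seq_boxes_in T.
Proof.
case=> [G p|G D|G a b|G a b D|G a b|G a b|G a b D|G a b|G p a D|G a b c D|
        G a b c D|G a b c D|P G a b D Pfree|P G a Pfree];
  rewrite !inE // => H; rewrite /seq_boxes_in; try have := @all_box_mset G.
all: repeat case/predU1P: H => [->|H]; try move/eqP: H => ->.
all: rewrite /= ?(all_mset1D, all_msetD, boxes_in_connective, boxes_in_Box).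
all: try lia.
- by move=> _ /and3P[-> -> ->].
- by move=> E /andP[/and3P[/andP[/andP[-> ->] ->] -> /[dup] /E -> ->] _].
- by move=> E /and3P[/andP[-> /[dup] /E -> ->] -> ->].
Qed.

Lemma leq_missing S T :
  (forall a, boxed a -> a \in S.1 -> a \in T.1) -> missing T <= missing S.
Proof.
move=> ST; apply: sub_count => a /= /andP[ba]; rewrite ba /=.
exact/contra/ST.
Qed.

Lemma ltn_missing S T a :
  (forall b, boxed b -> b \in S.1 -> b \in T.1) ->
  Box a \in U -> Box a \notin S.1 -> Box a \in T.1 -> missing T < missing S.
Proof.
move=> ST aU aS aT; apply: (ltn_sub_count (x := Box a)) => //=; last by rewrite aT.
by move=> b /= /andP[bb]; rewrite bb /=; apply/contra/ST.
Qed.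

Lemma cost_ltn a b : weight a < weight b -> cost a < cost b.
Proof. by rewrite /cost ltn_exp2l. Qed.

Lemma cost_ltn2 a b c :
  weight a < weight c -> weight b < weight c -> cost a + cost b < cost c.
Proof.
rewrite /cost; case: (weight c) => // n; rewrite !ltnS expnS => an bn.
have := leq_pexp2l (isT : 0 < 3) an; have := leq_pexp2l (isT : 0 < 3) bn.
have := expn_gt0 3 n; lia.
Qed.

(** The first alternative serves the left premise of [rule_impSL], which need not lower either
    measure when [Box a] is already in the antecedent. *)
Lemma premise_descent ps S T :
  G4iSL_box ps S -> T \in ps -> seq_boxes_in S -> ~~ extended_axiom S ->
  [|| extended_axiom T, missing T < missing S |
      (missing T <= missing S) && (seq_cost T < seq_cost S)].
Proof.
case=> [G p|G D|G a b|G a b D|G a b|G a b|G a b D|G a b|G p a D|G a b c D|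
        G a b c D|G a b c D|P G a b D Pfree|P G a Pfree];
  rewrite !inE // => H.
11: case/predU1P: H => [->|/eqP->].
(* All premises but the modal ones: the principal formula on the left is not boxed, so no box is
   lost, and the cost drops. *)
1-10,12: move=> _ _; apply/orP; right; apply/orP; right; apply/andP; split.
1-22: repeat case/predU1P: H => [->|H]; try move/eqP: H => ->.
all: try by apply: leq_missing => x bx; rewrite /= ?in_mset1D;
  repeat (case/predU1P => [xE|]; first by rewrite xE in bx); move=> ->; rewrite ?orbT.
1-14: rewrite /seq_cost /= ?sum_mset1D.
- by have := @cost_ltn a (And a b); rewrite /=; lia.
- by have := @cost_ltn b (And a b); rewrite /=; lia.
- by have := @cost_ltn2 a b (And a b); rewrite /=; lia.
- by have := @cost_ltn a (Or a b); rewrite /=; lia.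
- by have := @cost_ltn b (Or a b); rewrite /=; lia.
- by have := @cost_ltn a (Or a b); rewrite /=; lia.
- by have := @cost_ltn b (Or a b); rewrite /=; lia.
- by have := @cost_ltn2 a b (Imp a b); rewrite /=; lia.
- by have := @cost_ltn a (Imp (Atom p) a); rewrite /=; lia.
- by have := @cost_ltn (Imp a (Imp b c)) (Imp (And a b) c); rewrite /=; lia.
- by have := @cost_ltn2 (Imp a c) (Imp b c) (Imp (Or a b) c); rewrite /=; lia.
(* The new succedent [Imp a b] counts as the second lighter formula. *)
- by have := @cost_ltn2 (Imp b c) (Imp a b) (Imp (Imp a b) c); rewrite /=; lia.
- by have := @cost_ltn c (Imp (Imp a b) c); rewrite /=; lia.
- by have := @cost_ltn b (Imp (Box a) b); rewrite /=; lia.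
- rewrite /seq_boxes_in all_mset1D boxes_in_connective boxes_in_Box /=.
  move=> /andP[/andP[/andP[/andP[aU _] _] _] _] _.
  (* Since [P] is box-free and the principal formula is an implication, this decides whether [Box a]
     is in the antecedent of [S]. *)
  case: (boolP (a \in G)) => [aG|naG].
    apply/orP; left; rewrite /extended_axiom /=. by rewrite !in_msetD aG !orbT.
  apply/orP; right; apply/orP; left; apply: (ltn_missing (a := a)) => //=.
  + by move=> x _; rewrite !in_msetD => /or3P[] ->; rewrite ?orbT.
  + rewrite !in_msetD mem_box_mset (negPf naG) orbF in_mset1 negb_or /=.
    by apply/contraTN: isT => /Pfree.
  + by rewrite in_mset1D mset1D1 orbT.
- move/eqP: H => ->; rewrite /seq_boxes_in /= boxes_in_Box.
  (* Here [naS] says precisely that [Box a] is not in the antecedent of [S]. *)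
  move=> /and3P[_ aU _] naS; apply/orP; right; apply/orP; left.
  apply: (ltn_missing (a := a)) => //=; last by rewrite mset1D1.
  by move=> x _; rewrite !in_msetD => /orP[] ->; rewrite ?orbT.
Qed.

(** The outer induction is on [missing], the inner one on [seq_cost], because a modal premise can
    raise the cost by copying formulas out of their boxes. *)
Lemma Acc_expands S : seq_boxes_in S -> Acc (expands G4iSL_box) S.
Proof.
have [m] := ubnP (missing S); elim: m S => [|m IHm] S; first by rewrite ltn0.
have [k] := ubnP (seq_cost S); elim: k S => [|k IHk] S; first by rewrite ltn0.
move=> Sk Sm US.
constructor=> T [naS [ps Cps Tps]].
have UT := seq_boxes_in_premise Cps Tps US.
have /or3P[axT|TS|/andP[TSm TSk]] := premise_descent Cps Tps US naS.
- by constructor=> T' []; rewrite axT.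
- by apply: IHm => //; apply: leq_trans TS _.
- by apply: IHk => //; [apply: leq_trans TSk _|apply: leq_ltn_trans TSm _].
Qed.

End Descent.

Lemma seq_boxes_in_exists S : exists U, seq_boxes_in U S.
Proof.
case: S => G D; pose s := (G : seq formula) ++ seq_of_opt D.
exists (flatten [seq boxed_subformulas a | a <- s]).
have sU a : a \in s -> boxes_in (flatten [seq boxed_subformulas a | a <- s]) a.
  by move=> a_s; apply/allP => b ba; apply/flatten_mapP; exists a.
apply/andP; split; first by apply/allP => a aG; apply: sU; rewrite mem_cat aG.
by case: D @s sU => //= a sU; apply: sU; rewrite mem_cat mem_head orbT.
Qed.

Theorem theorem2 : terminates_modulo_extended_axioms G4iSL_box.
Proof.
move=> S; have [U US] := seq_boxes_in_exists S.
exact: finite_search_node instancesP (Acc_expands US).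
Qed.
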